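(* Let $R$ be an associative ring with identity and $p$ a prime number. The map $\theta_p\colon H_0(R)\to H_0(R/pR)$ defined by $\theta_p([r])=[r^p]$ is a well-defined homomorphism.
   Context: For a ring $A$, $H_0(A)$ is the quotient of the additive group of $A$ by the subgroup generated by all $rs-sr$, $r,s\in A$; $[r]$ denotes the class of $r$. *)

(* Defs.v *)
From HB Require Import structures.
From mathcomp Require Import all_boot all_order all_algebra.
From mathcomp Require Import boolp.
Set Implicit Arguments.
Unset Strict Implicit.
Unset Printing Implicit Defensive.
Import GRing.Theory.
Local Open Scope ring_scope.
Local Open Scope quotient_scope.

(* Rings are [pzRingType]s: associative with identity, possibly zero (R/pR is
   the zero ring when p is invertible in R). *)

Section AdditiveClosure.
Variables (V : zmodType) (G : V -> Prop).

(* The intersection of all additive subgroups of V containing G. *)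
Definition subgroup_gen : {pred V} := fun x =>
  `[< forall S : {pred V}, zmod_closed S -> (forall g, G g -> g \in S) ->
        x \in S >].

Lemma subgroup_gen_zmod_closed : zmod_closed subgroup_gen.
Proof.
split=> [|x y /asboolP xG /asboolP yG]; apply/asboolP => S Scl GS.
  exact: Scl.1.
by apply: Scl.2; [apply: xG | apply: yG].
Qed.

HB.instance Definition _ :=
  GRing.isZmodClosed.Build V subgroup_gen subgroup_gen_zmod_closed.

End AdditiveClosure.

Definition is_commutator (A : pzRingType) (x : A) : Prop :=
  exists r s : A, x = r * s - s * r.

Definition H0 (A : pzRingType) : Type :=
  Quotient.quot (subgroup_gen (@is_commutator A)).
HB.instance Definition _ (A : pzRingType) := Choice.on (H0 A).
HB.instance Definition _ (A : pzRingType) := GRing.Zmodule.on (H0 A).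

Definition H0_class (A : pzRingType) (r : A) : H0 A :=
  \pi_(Quotient.quot (subgroup_gen (@is_commutator A))) r.

(* The library's quotient of rings is restricted to proper ideals of
   commutative rings, so the product of R/nR is put here on the library's
   quotient of the additive group. *)
Section RingModN.
Variables (R : pzRingType) (n : nat).

Definition multiples : {pred R} := fun x => `[< exists y : R, x = n%:R * y >].

Lemma multiples_zmod_closed : zmod_closed multiples.
Proof.
split=> [|x y /asboolP[a ->] /asboolP[b ->]]; apply/asboolP.
  by exists 0; rewrite mulr0.
by exists (a - b); rewrite mulrBr.
Qed.

HB.instance Definition _ :=
  GRing.isZmodClosed.Build R multiples multiples_zmod_closed.

Lemma multiplesMl a x : x \in multiples -> a * x \in multiples.
Proof.
by move=> /asboolP[y ->]; apply/asboolP; exists (a * y); rewrite !mulrA commr_nat.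
Qed.

Lemma multiplesMr a x : x \in multiples -> x * a \in multiples.
Proof. by move=> /asboolP[y ->]; apply/asboolP; exists (y * a); rewrite mulrA. Qed.

Definition ring_mod : Type := Quotient.quot multiples.
HB.instance Definition _ := Choice.on ring_mod.
HB.instance Definition _ := GRing.Zmodule.on ring_mod.

Definition to_mod (x : R) : ring_mod := \pi_(Quotient.quot multiples) x.

Definition ring_mod_one : ring_mod := to_mod 1.
Definition ring_mod_mul (x y : ring_mod) : ring_mod := to_mod (repr x * repr y).

Lemma to_mod_eqP x y : reflect (to_mod x = to_mod y) (x - y \in multiples).
Proof. by rewrite Quotient.idealrBE; apply: eqP. Qed.

Lemma to_mod_repr (x : ring_mod) : to_mod (repr x) = x.
Proof. exact: reprK. Qed.

Lemma to_mod_is_zmod_morphism : zmod_morphism to_mod.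
Proof. exact: (raddfB (\pi_(Quotient.quot multiples))). Qed.

Lemma to_modM x y : to_mod (x * y) = ring_mod_mul (to_mod x) (to_mod y).
Proof.
rewrite /ring_mod_mul; set x' := repr _; set y' := repr _.
have xx' : x - x' \in multiples by apply/to_mod_eqP; rewrite to_mod_repr.
have yy' : y - y' \in multiples by apply/to_mod_eqP; rewrite to_mod_repr.
apply/to_mod_eqP; have -> : x * y - x' * y' = x * (y - y') + (x - x') * y'.
  by rewrite mulrBr mulrBl addrA subrK.
exact: rpredD (multiplesMl x yy') (multiplesMr y' xx').
Qed.

Lemma ring_mod_mulA : associative ring_mod_mul.
Proof.
move=> x y z; rewrite -(to_mod_repr x) -(to_mod_repr y) -(to_mod_repr z).
by rewrite -!to_modM mulrA.
Qed.

Lemma ring_mod_mul1l : left_id ring_mod_one ring_mod_mul.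
Proof. by move=> x; rewrite -(to_mod_repr x) -to_modM mul1r. Qed.

Lemma ring_mod_mul1r : right_id ring_mod_one ring_mod_mul.
Proof. by move=> x; rewrite -(to_mod_repr x) -to_modM mulr1. Qed.

HB.instance Definition _ :=
  GRing.isZmodMorphism.Build R ring_mod to_mod to_mod_is_zmod_morphism.

Lemma ring_mod_mulDl : left_distributive ring_mod_mul +%R.
Proof.
move=> x y z; rewrite -(to_mod_repr x) -(to_mod_repr y) -(to_mod_repr z).
by rewrite -raddfD -!to_modM mulrDl raddfD.
Qed.

Lemma ring_mod_mulDr : right_distributive ring_mod_mul +%R.
Proof.
move=> x y z; rewrite -(to_mod_repr x) -(to_mod_repr y) -(to_mod_repr z).
by rewrite -raddfD -!to_modM mulrDr raddfD.
Qed.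

HB.instance Definition _ := GRing.Zmodule_isPzRing.Build ring_mod
  ring_mod_mulA ring_mod_mul1l ring_mod_mul1r ring_mod_mulDl ring_mod_mulDr.

Lemma to_mod_is_monoid_morphism : monoid_morphism to_mod.
Proof. by split=> // x y; rewrite to_modM. Qed.

HB.instance Definition _ :=
  GRing.isMonoidMorphism.Build R ring_mod to_mod to_mod_is_monoid_morphism.

End RingModN.

Arguments to_mod {R} n x.

(* Main.v *)
(** Expand [(a + b) ^ p] into words of length [p] in [a] and [b].  Rotating a
    word does not change its class in [H_0], and [Z/p] acts on the words by
    rotation with the two constant words as only fixed points; all other orbits
    have [p] elements and contribute [0] as soon as [p] kills the ring.  Hence
    [a |-> [a ^ p]] is additive, and it kills commutators since
    [(r s) ^ p = r (s (r s) ^ (p - 1))] is a rotation of [(s r) ^ p]. *)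

Require Import Defs.
From HB Require Import structures.
From mathcomp Require Import all_boot all_order all_algebra fingroup.
From mathcomp Require Import perm action cyclic generic_quotient boolp.
Set Implicit Arguments.
Unset Strict Implicit.
Unset Printing Implicit Defensive.
Import GRing.Theory.
Local Open Scope ring_scope.
Local Open Scope quotient_scope.

(** Orbit sizes divide [p], so an orbit of moved points has exactly [p] elements; as [F] is constant
    on it, it contributes a multiple of [p], which vanishes in [V]. *)
Lemma sum_perm_fixed (V : zmodType) (T : finType) (p : nat) (s : {perm T})
    (F : T -> V) :
  prime p -> (s ^+ p = 1)%g -> (forall v : V, v *+ p = 0) ->
  (forall x, F (s x) = F x) ->
  \sum_x F x = \sum_(x | s x == x) F x.
Proof.
move=> p_pr sp1 pV0 Fs; rewrite (bigID (fun x => s x == x)) /=.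
rewrite [X in _ + X](_ : _ = 0) ?addr0 //.
rewrite (partition_big (porbit s) predT) //=; apply: big1 => B _.
(* [B] ranges over all subsets of [T]; if it is not the orbit of a moved point, its sum is empty. *)
case: (pickP [pred x | (s x != x) && (porbit s x == B)]) => [x /=|B0]; last first.
  by rewrite big_pred0.
case/andP=> sx /eqP Bx.
have porbit_fix y : (s y == y) = (#|porbit s y| == 1%N).
  apply/eqP/eqP => [sy | /eqP/cards1P[z yz]].
    apply/eqP/cards1P; exists y; apply/setP => z; rewrite inE.
    apply/porbitP/eqP => [[n ->]|->]; last by exists 0; rewrite expg0 perm1.
    by elim: n => [|n IHn]; rewrite ?expg0 ?perm1 // expgSr permM IHn.
  have /set1P-> : s y \in [set z] by rewrite -yz -{1}(expg1 s) mem_porbit.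
  by apply/esym/set1P; rewrite -yz porbit_id.
have FB y : y \in porbit s x -> F y = F x.
  case/porbitP=> n ->; elim: n => [|n IHn]; rewrite ?expg0 ?perm1 //.
  by rewrite expgSr permM Fs.
have cardB : #|porbit s x| = p.
  have : (#|porbit s x| %| p)%N.
    rewrite porbitE (dvdn_trans (dvdn_orbit _ _ _)) //.
    by rewrite -orderE order_dvdn sp1.
  by case/primeP: p_pr => _ /[apply] /orP[]/eqP // ox1; rewrite porbit_fix ox1 in sx.
rewrite (eq_bigl (mem (porbit s x))) => [|y].
  by rewrite (eq_bigr (fun=> F x)) // sumr_const cardB.
rewrite /= porbit_fix -Bx; apply/andP/idP => [[_ /eqP<-]|]; first exact: porbit_id.
rewrite -eq_porbit_mem => /eqP ->; split=> //.
by rewrite cardB neq_ltn prime_gt1 // orbT.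
Qed.

Section H0Class.
Variable A : pzRingType.

Lemma H0_class_is_zmod_morphism : zmod_morphism (@H0_class A).
Proof. exact: (raddfB (\pi_(Quotient.quot (subgroup_gen (@is_commutator A))))). Qed.

HB.instance Definition _ :=
  GRing.isZmodMorphism.Build A (H0 A) (@H0_class A) H0_class_is_zmod_morphism.

Lemma H0_class_repr (x : H0 A) : H0_class (repr x) = x.
Proof. exact: reprK. Qed.

Lemma H0_class_eqP (x y : A) :
  reflect (H0_class x = H0_class y) (x - y \in subgroup_gen (@is_commutator A)).
Proof. by rewrite Quotient.idealrBE; apply: eqP. Qed.

Lemma H0_classMC (r s : A) : H0_class (r * s) = H0_class (s * r).
Proof.
by apply/H0_class_eqP/asboolP => S _; apply; exists r, s.
Qed.

Lemma H0_class_exprMC (r s : A) n :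
  H0_class ((r * s) ^+ n) = H0_class ((s * r) ^+ n).
Proof.
case: n => [|n]; first by rewrite !expr0.
(* Once the leading [r] has been carried to the end, this regroups the remaining word into a power
   of [s * r]. *)
have rot : s * (r * s) ^+ n = (s * r) ^+ n * s.
  elim: n => [|n IHn]; first by rewrite !expr0 mulr1 mul1r.
  by rewrite exprSr mulrA IHn exprSr !mulrA.
by rewrite exprS -mulrA H0_classMC rot -mulrA -exprSr.
Qed.

End H0Class.

(** The two products differ only in that [g ord0] stands last in one and first in the other, so a
    single exchange of two factors suffices. *)
Lemma H0_class_prod_rot (A : pzRingType) n (g : 'I_n -> A) :
  H0_class (\prod_i g (ordS i)) = H0_class (\prod_i g i).
Proof.
case: n g => [|n] g; first by rewrite !big_ord0.
rewrite big_ord_recr big_ord_recl [RHS]H0_classMC /=; congr (H0_class (_ * _)).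
  by apply: eq_bigr => i _; congr g; apply: val_inj; rewrite /= modn_small // ltnS.
by congr g; apply: val_inj; rewrite /= modnn.
Qed.

(** Used with [k = n], to see that [n] rotations restore a word, and from index 0, which reaches
    every index. *)
Lemma iter_ordS n (i : 'I_n) k : iter k (@ordS n) i = ((i + k) %% n)%N :> nat.
Proof.
elim: k => [|k IHk] /=; first by rewrite addn0 modn_small.
by rewrite IHk -addn1 modnDml addn1 addnS.
Qed.

Definition word_rot n (w : {ffun 'I_n -> bool}) : {ffun 'I_n -> bool} :=
  [ffun i => w (ordS i)].

Lemma word_rot_inj n : injective (@word_rot n).
Proof.
move=> w w' /ffunP ww'; apply/ffunP => i.
by have := ww' (ord_pred i); rewrite !ffunE ord_predK.
Qed.

Lemma word_rot_expg n k (w : {ffun 'I_n -> bool}) i :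
  (perm (@word_rot_inj n) ^+ k)%g w i = w (iter k (@ordS n) i).
Proof.
elim: k i => [|k IHk] i; first by rewrite expg0 perm1.
by rewrite expgSr permM permE ffunE IHk -iterSr.
Qed.

Lemma word_rot_fixed n (w : {ffun 'I_n.+1 -> bool}) :
  (word_rot w == w) = (w == [ffun=> true]) || (w == [ffun=> false]).
Proof.
apply/eqP/orP => [/ffunP rw | [] /eqP->]; last 2 first.
- by apply/ffunP=> i; rewrite !ffunE.
- by apply/ffunP=> i; rewrite !ffunE.
have w0 (i : 'I_n.+1) : w i = w ord0.
  have -> : i = iter i (@ordS n.+1) ord0.
    by apply: ord_inj; rewrite iter_ordS add0n modn_small.
  by elim: (nat_of_ord i) => //= k <-; rewrite -[in RHS]rw ffunE.
by case: (w ord0) w0 => w0; [left|right]; apply/eqP/ffunP => i; rewrite ffunE.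
Qed.

Lemma H0_class_exprD (A : pzRingType) p (a b : A) :
  prime p -> p%:R = 0 :> A ->
  H0_class ((a + b) ^+ p) = H0_class (a ^+ p) + H0_class (b ^+ p).
Proof.
move=> p_pr pA0; pose x (c : bool) := if c then a else b.
have pH0 (v : H0 A) : v *+ p = 0.
  by rewrite -(H0_class_repr v) -raddfMn -mulr_natl pA0 mul0r raddf0.
(* Distributivity: [w] records which summand is chosen in each factor. *)
have -> : (a + b) ^+ p = \sum_(w : {ffun 'I_p -> bool}) \prod_i x (w i).
  rewrite -(bigA_distr_bigA (fun _ c => x c)) /= big_bool.
  by rewrite prodr_const card_ord.
rewrite raddf_sum (sum_perm_fixed (s := perm (@word_rot_inj p)) p_pr) //=.
- under eq_bigl => w do rewrite permE.
  case: p p_pr {pA0 pH0} => // n _; under eq_bigl => w do rewrite word_rot_fixed.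
  (* The two constant words differ at index 0, which exists since [p] is positive. *)
  rewrite (bigD1 [ffun=> true]) ?eqxx //= (bigD1 [ffun=> false]) /=; last first.
    rewrite eqxx orbT /=; apply/eqP => /ffunP/(_ ord0).
    by rewrite !ffunE.
  rewrite [X in _ + (_ + X)]big1 ?addr0 => [|w /andP[/andP[/orP[] ->]]] //.
  have const c : \prod_(i < n.+1) x ([ffun=> c] i) = x c ^+ n.+1.
    by under eq_bigr do rewrite ffunE; rewrite prodr_const card_ord.
  by rewrite !const.
- apply/permP => w; apply/ffunP => i; rewrite word_rot_expg perm1; congr (w _).
  by apply: val_inj; rewrite /= iter_ordS modnDr modn_small.
- move=> w; rewrite permE -[RHS]H0_class_prod_rot; congr H0_class.
  by apply: eq_bigr => i _; rewrite ffunE.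
Qed.

(** The kernel of [f] is an additive subgroup containing all commutators, hence contains the
    subgroup they generate; so [f] of a chosen representative depends only on the class. *)
Lemma H0_lift (A : pzRingType) (V : zmodType) (f : {additive A -> V}) :
  (forall r s, f (r * s) = f (s * r)) ->
  exists g : {additive H0 A -> V}, forall r, g (H0_class r) = f r.
Proof.
move=> fC; pose g (x : H0 A) := f (repr x).
have gE r : g (H0_class r) = f r.
  apply/eqP; rewrite -subr_eq0 -raddfB; apply/eqP.
  have /H0_class_eqP/asboolP := H0_class_repr (H0_class r).
  move=> /(_ [pred x | f x == 0]) ker; apply/eqP/ker; last first.
    by move=> _ [a [b ->]]; rewrite inE raddfB fC subrr.
  split=> [|x y]; rewrite !inE ?raddf0 // => /eqP fx /eqP fy.
  by rewrite raddfB fx fy subrr.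
have gB : zmod_morphism g.
  move=> x y; rewrite -(H0_class_repr x) -(H0_class_repr y) -raddfB !gE.
  exact: raddfB.
pose gM := GRing.isZmodMorphism.Build _ _ g gB.
by exists (HB.pack_for {additive H0 A -> V} g gM).
Qed.

Theorem proposition2p2 (R : pzRingType) (p : nat) (hp : prime p) :
  exists theta : {additive H0 R -> H0 (ring_mod R p)},
    forall r : R, theta (H0_class r) = H0_class (to_mod p (r ^+ p)).
Proof.
pose f (r : R) := H0_class (to_mod p (r ^+ p)).
have p0 : p%:R = 0 :> ring_mod R p.
  rewrite -(rmorph_nat (to_mod p)) -(raddf0 (to_mod p)); apply/to_mod_eqP.
  by rewrite subr0; apply/asboolP; exists 1; rewrite mulr1.
(* Reduction mod [p] commutes with powers, so the computation takes place in [ring_mod R p], where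
   [p] is 0. *)
have fD : {morph f : x y / x + y}.
  by move=> x y; rewrite /f !rmorphXn raddfD; apply: H0_class_exprD.
have fB : zmod_morphism f.
  by move=> x y; apply/eqP; rewrite eq_sym subr_eq -fD subrK.
pose fM := GRing.isZmodMorphism.Build _ _ f fB.
apply: (H0_lift (f := HB.pack_for {additive R -> H0 (ring_mod R p)} f fM)) => r s.
by rewrite /= /f !rmorphXn !rmorphM H0_class_exprMC.
Qed.
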